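(* Let $Z$ be a closed proper subset of $\mathbb C$ which is determining for $\mathbb C[z,\bar z]$ and let $\tau$ be an evaluable locally convex topology on $\mathbb C[z,\bar z]$. Then there exists a polynomial $p\in\mathbb C[z,\bar z]$ which is nonnegative on $Z$ (i.e. $p(z,\bar z)\ge0$ for all $z\in Z$) and which does not belong to the $\tau$-closure of $\Sigma^2(Z)$. In particular, $p$ is not in $\Sigma^2(Z)$.
   Context: $\mathbb C[z,\bar z]$ is the ring of all complex polynomials in $z$ and $\bar z$; a set $Z\subset\mathbb C$ is determining for $\mathbb C[z,\bar z]$ if every $p\in\mathbb C[z,\bar z]$ with $p(z,\bar z)=0$ for all $z\in Z$ vanishes identically. A locally convex topology $\tau$ on the linear space $\mathbb C[z,\bar z]$ is evaluable if the set of all $\lambda\in\mathbb C$ for which the evaluation $\mathbb C[z,\bar z]\ni p\mapsto p(\lambda,\bar\lambda)\in\mathbb C$ is $\tau$-continuous is dense in $\mathbb C$. $\mathbb C_{\mathfrak N_+}(z,\bar z)$ is the set of all functions on $\mathbb C\setminus\{0\}$ of the form $z\mapsto\sum_{m,n\in\mathbb Z,\ m+n\ge0}a_{m,n}z^m\bar z^n$ with only finitely many nonzero coefficients $a_{m,n}\in\mathbb C$. $\Sigma^2(Z)$ is the set of all polynomials $q\in\mathbb C[z,\bar z]$ for which there exist finitely many $q_1,\dots,q_n\in\mathbb C_{\mathfrak N_+}(z,\bar z)$ such that $q(z,\bar z)=\sum_{j=1}^n|q_j(z,\bar z)|^2$ for all $z\in Z\setminus\{0\}$. *)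

(* Defs.v *)
From HB Require Import structures.
From mathcomp Require Import all_boot all_order all_algebra.
From mathcomp Require Import finmap complex.
From mathcomp Require Import all_classical all_reals topology normedtype convex.
(* notations left out: those of mpoly clash with the ones of mathcomp-analysis *)
From mathcomp Require Import (canonicals, coercions) mpoly.

Set Implicit Arguments.
Unset Strict Implicit.
Unset Printing Implicit Defensive.

Import Order.TTheory GRing.Theory Num.Theory.
Import numFieldNormedType.Exports.

Local Open Scope classical_set_scope.
Local Open Scope ring_scope.

Record topology_on (T : Type) := TopologyOn {
  topo_open : set_system T ;
  topo_openT : topo_open setT ;
  topo_openI : setI_closed topo_open ;
  topo_open_bigU : forall (I : Type) (f : I -> set T),
    (forall i, topo_open (f i)) -> topo_open (\bigcup_i f i)
}.

(* A copy of T, so that the library's topological notions on it refer to tau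
   and not to any topology T may carry canonically. *)
Definition topologized (T : Type) (tau : topology_on T) : Type := T.

HB.instance Definition _ (T : choiceType) (tau : topology_on T) :=
  Choice.copy (topologized tau) T.
HB.instance Definition _ (T : choiceType) (tau : topology_on T) :=
  isOpenTopological.Build (topologized tau)
    (topo_openT tau) (@topo_openI T tau) (@topo_open_bigU T tau).
HB.instance Definition _ (K : numFieldType) (V : lmodType K)
    (tau : topology_on V) :=
  GRing.Lmodule.copy (topologized tau) V.

(* The last three fields are the axioms of the library's tvsType; as in the
   library, the Hausdorff axiom is not part of local convexity. *)
Record lctopology (K : numFieldType) (V : lmodType K) := LCTopology {
  lct_topology :> topology_on V ;
  lct_add_continuous :
    continuous (fun x : topologized lct_topology * topologized lct_topology =>
      (x.1 + x.2 : topologized lct_topology)) ;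
  lct_scale_continuous :
    continuous (fun x : K^o * topologized lct_topology =>
      (x.1 *: x.2 : topologized lct_topology)) ;
  lct_locally_convex :
    exists2 B : set_system (topologized lct_topology),
      (forall b, b \in B -> convex_set b) & basis B
}.

Definition lcspace (K : numFieldType) (V : lmodType K) (tau : lctopology V) :
  Type := topologized tau.

HB.instance Definition _ (K : numFieldType) (V : lmodType K)
    (tau : lctopology V) :=
  PreTopologicalLmodule.copy (lcspace tau) (topologized tau).
HB.instance Definition _ (K : numFieldType) (V : lmodType K)
    (tau : lctopology V) :=
  PreTopologicalNmodule_isTopologicalNmodule.Build (lcspace tau)
    (@lct_add_continuous K V tau).
HB.instance Definition _ (K : numFieldType) (V : lmodType K)
    (tau : lctopology V) :=
  TopologicalNmodule_isTopologicalLmodule.Build K (lcspace tau)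
    (@lct_scale_continuous K V tau).
(* In this version of the library, the next factory only builds the uniform
   structure. *)
HB.instance Definition _ (K : numFieldType) (V : lmodType K)
    (tau : lctopology V) :=
  PreTopologicalLmod_isTvs.Build K (lcspace tau)
    (@lct_add_continuous K V tau) (@lct_scale_continuous K V tau)
    (@lct_locally_convex K V tau).
HB.instance Definition _ (K : numFieldType) (V : lmodType K)
    (tau : lctopology V) :=
  Uniform_isTvs.Build K (lcspace tau) (@lct_locally_convex K V tau).

(* C[z, \bar z]: the variable of index 0 is z, that of index 1 is \bar z. *)
Notation polyzz R := (mpoly.mpoly 2 (complex R)).

Definition evalzz (R : realType) (p : polyzz R) (z : R[i]) : R[i] :=
  mpoly.meval (tnth [tuple z; z^*%R]) p.

Definition determining (R : realType) (Z : set R[i]) :=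
  forall p : polyzz R, (forall z, Z z -> evalzz p z = 0) ->
    forall z, evalzz p z = 0.

Definition evaluable (R : realType) (tau : lctopology (polyzz R)) :=
  dense [set l : R[i]^o |
    continuous ((fun p : polyzz R => evalzz p l) : lcspace tau -> R[i]^o)].

(* Functions on C \ {0}, represented by total functions whose value at 0 is
   arbitrary and never used. *)
Definition Nplus_function (R : realType) : set (R[i] -> R[i]) :=
  [set f | exists2 a : {fsfun int * int -> R[i] with 0},
    (forall k, k \in finsupp a -> 0 <= k.1 + k.2) &
    forall z, z != 0 ->
      f z = \sum_(k <- finsupp a) a k * z ^ k.1 * z^*%R ^ k.2].

(* `|x| is the modulus of x, as an element of R[i]. *)
Definition Sigma2 (R : realType) (Z : set R[i]) : set (polyzz R) :=
  [set q | exists (n : nat) (f : 'I_n -> R[i] -> R[i]),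
    (forall j, Nplus_function (f j)) /\
    forall z, Z z -> z != 0 -> evalzz q z = \sum_(j < n) `|f j z| ^+ 2].

(* Main.v *)
Require Import Defs.
From mathcomp Require Import all_boot all_order all_algebra.
From mathcomp Require Import finmap complex.
From mathcomp Require Import all_classical all_reals topology normedtype.
From mathcomp Require Import (canonicals, coercions) mpoly.

Import Order.TTheory GRing.Theory Num.Theory.
Import numFieldNormedType.Exports.

Local Open Scope classical_set_scope.
Local Open Scope ring_scope.

(** Choose a point [l <> 0] outside [Z] at which evaluation is tau-continuous.
    If [q] is a sum of squares on [Z], multiplying by a power of [|z|^2] turns
    the identity into one between polynomials; as [Z] is determining, it holds
    on all of [C \ {0}], so [q(l) >= 0], and by continuity this persists on the
    closure.  But [|z - l|^2 - e^2] is nonnegative on [Z] for small [e] and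
    negative at [l]. *)

Lemma conjC_monomial (C : numClosedFieldType) (a z : C) (m n : int) : z != 0 ->
  (a * z ^ m * z^* ^ n)^* = a^* * z^* ^ m * z ^ n.
Proof.
move=> z0; have zb0 : z^* != 0 by rewrite conjC_eq0.
by rewrite !rmorphM /= !rmorphXz ?unitfE //= conjCK.
Qed.

(** The ball of radius [- c] around [c] contains no nonnegative element. On [R[i]] the order is
    partial and the negative reals are no neighbourhood of [c], whence the negated form of the
    set. *)
Lemma nbhs_lt0 (K : numFieldType) (c : K) : c < 0 ->
  nbhs (c : K^o) [set x : K^o | ~~ (0 <= x :> K)].
Proof.
move=> c0; apply/nbhs_ballP; exists (- c); rewrite /= ?oppr_gt0 // => x.
rewrite /ball /= => cx; apply/negP => x0; move: cx.
rewrite distrC ger0_norm ?subr_ge0 ?(le_trans (ltW c0))//.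
by rewrite ltrBlDr addNr => /(le_lt_trans x0); rewrite ltxx.
Qed.

Lemma sqr_le_norm (K : numDomainType) (e x : K) : 0 < e -> ~~ (`|x| < e) ->
  e ^+ 2 <= `|x| ^+ 2.
Proof.
move=> e0; rewrite -real_leNgt ?normr_real ?gtr0_real // => ex.
by rewrite ler_pXn2r // nnegrE ?normr_ge0 // ltW.
Qed.

Section EvalZZ.
Variable R : realType.
Implicit Types (p q : polyzz R) (z c : R[i]) (f g : R[i] -> R[i]).

Definition zvar : polyzz R := mpoly.mpolyX R[i] (mpoly.mnm1 (ord0 : 'I_2)).
Definition zbarvar : polyzz R :=
  mpoly.mpolyX R[i] (mpoly.mnm1 (lift ord0 ord0 : 'I_2)).
Definition zzC c : polyzz R := mpoly.mpolyC 2 c.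

Lemma evalzz_zvar z : evalzz zvar z = z.
Proof. by rewrite /evalzz mpoly.mevalXU. Qed.

Lemma evalzz_zbarvar z : evalzz zbarvar z = z^*.
Proof. by rewrite /evalzz mpoly.mevalXU. Qed.

Lemma evalzzC c z : evalzz (zzC c) z = c.
Proof. exact: mpoly.mevalC. Qed.

Lemma evalzzD p q z : evalzz (p + q) z = evalzz p z + evalzz q z.
Proof. exact: mpoly.mevalD. Qed.

Lemma evalzzB p q z : evalzz (p - q) z = evalzz p z - evalzz q z.
Proof. exact: mpoly.mevalB. Qed.

Lemma evalzzM p q z : evalzz (p * q) z = evalzz p z * evalzz q z.
Proof. exact: mpoly.mevalM. Qed.

Lemma evalzzX p n z : evalzz (p ^+ n) z = evalzz p z ^+ n.
Proof.
elim: n => [|n IH]; last by rewrite !exprS evalzzM IH.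
exact: (evalzzC 1 z).
Qed.

(* [evalzzD] would also match [p - q], hence comes after [evalzzB] *)
Definition evalzzE :=
  (evalzz_zvar, evalzz_zbarvar, evalzzC, evalzzB, evalzzD, evalzzM, evalzzX).

(** Off 0, these are the fractions with a polynomial numerator and a power of [z * z^*] as
    denominator. They form an algebra, and [determining] applies to their numerators. *)
Definition clearable f := exists (N : nat) (p : polyzz R),
  forall z, z != 0 -> (z * z^*) ^+ N * f z = evalzz p z.

Lemma clearable_ext f g :
  (forall z, z != 0 -> f z = g z) -> clearable f -> clearable g.
Proof.
by move=> fg [N [p pE]]; exists N, p => z z0; rewrite -fg // pE.
Qed.

Lemma clearable_cst c : clearable (fun=> c).
Proof. by exists 0, (zzC c) => z _; rewrite expr0 mul1r evalzzE. Qed.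

Lemma clearableD f g :
  clearable f -> clearable g -> clearable (fun z => f z + g z).
Proof.
move=> [M [p pE]] [N [q qE]].
exists (M + N)%N, ((zvar * zbarvar) ^+ N * p + (zvar * zbarvar) ^+ M * q).
move=> z z0; rewrite !evalzzE -pE// -qE// exprD mulrDr !mulrA.
by congr (_ * _ + _); rewrite mulrC.
Qed.

Lemma clearableM f g :
  clearable f -> clearable g -> clearable (fun z => f z * g z).
Proof.
move=> [M [p pE]] [N [q qE]]; exists (M + N)%N, (p * q) => z z0.
by rewrite evalzzE -pE// -qE// exprD mulrACA.
Qed.

Lemma clearable_sum (I : Type) (r : seq I) (F : I -> R[i] -> R[i]) :
  (forall i, clearable (F i)) -> clearable (fun z => \sum_(i <- r) F i z).
Proof.
move=> FE; elim: r => [|i r IH].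
  by apply: clearable_ext (clearable_cst 0) => z _; rewrite big_nil.
by apply: clearable_ext (clearableD _ _ (FE i) IH) => z _; rewrite big_cons.
Qed.

Lemma clearable_expz (k : int) : clearable (fun z => z ^ k).
Proof.
case: k => n.
  by exists 0, (zvar ^+ n) => z _; rewrite expr0 mul1r !evalzzE.
exists n.+1, (zbarvar ^+ n.+1) => z z0; rewrite !evalzzE NegzE exprMn mulrAC.
by rewrite -exprnN divff ?mul1r// expf_neq0.
Qed.

Lemma clearable_conj_expz (k : int) : clearable (fun z => z^* ^ k).
Proof.
case: k => n.
  by exists 0, (zbarvar ^+ n) => z _; rewrite expr0 mul1r !evalzzE.
exists n.+1, (zvar ^+ n.+1) => z z0; rewrite !evalzzE NegzE exprMn -mulrA.
by rewrite -exprnN divff ?mulr1// expf_neq0 // conjC_eq0.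
Qed.

Lemma Nplus_clearable f : Nplus_function f -> clearable f.
Proof.
move=> [a _ fE]; apply: clearable_ext => [z z0|]; first exact: esym (fE z z0).
apply: clearable_sum => k; apply: clearableM (clearable_conj_expz _).
exact: clearableM (clearable_cst _) (clearable_expz _).
Qed.

(** Needed because the squared modulus of [f z] is handled as [f z * (f z)^*]. Conjugation turns
    each monomial into one with the two exponents exchanged. *)
Lemma Nplus_clearable_conj f :
  Nplus_function f -> clearable (fun z => (f z)^*).
Proof.
move=> [a _ fE].
apply: (@clearable_ext (fun z => \sum_(k <- finsupp a)
  (a k)^* * z^* ^ k.1 * z ^ k.2)) => [z z0|].
  rewrite fE// rmorph_sum; apply: eq_bigr => k _.
  exact/esym/conjC_monomial.
apply: clearable_sum => k; apply: clearableM (clearable_expz _).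
exact: clearableM (clearable_cst _) (clearable_conj_expz _).
Qed.

(** Clearing the denominator of [q - f] leaves a polynomial that vanishes on [Z], hence everywhere;
    off 0 the factor [z * z^*] can be cancelled again. *)
Lemma determining_clearable (Z : set R[i]) q f : determining Z -> clearable f ->
  (forall z, Z z -> z != 0 -> evalzz q z = f z) ->
  forall z, z != 0 -> evalzz q z = f z.
Proof.
move=> Zdet [N [p pE]] qf z z0.
(* the exponent [N.+1] makes both sides vanish at 0, which may lie in [Z] *)
have pq0 : forall w, Z w ->
    evalzz ((zvar * zbarvar) ^+ N.+1 * q - zvar * zbarvar * p) w = 0.
  move=> w Zw; rewrite !evalzzE exprS.
  have [->|w0] := eqVneq w 0; first by rewrite !mul0r subrr.
  by rewrite -pE// qf// -!mulrA subrr.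
have := Zdet _ pq0 z; rewrite !evalzzE exprS -pE// -!mulrA -!mulrBr => /eqP.
by rewrite !mulf_eq0 conjC_eq0 expf_eq0 mulf_eq0 conjC_eq0 !(negPf z0) andbF
  subr_eq0 => /eqP.
Qed.

Lemma Sigma2_ge0 (Z : set R[i]) q z : determining Z -> Sigma2 Z q -> z != 0 ->
  0 <= evalzz q z.
Proof.
move=> Zdet [n [f [fN qE]]] z0.
rewrite (@determining_clearable Z q (fun z => \sum_(j < n) `|f j z| ^+ 2))//.
  by apply: sumr_ge0 => j _; exact: exprn_ge0.
apply: clearable_sum => j.
have fj := fN j.
have := clearableM _ _ (Nplus_clearable _ fj) (Nplus_clearable_conj _ fj).
by apply: clearable_ext => w _; rewrite normCK.
Qed.

Lemma evalzz_sqr_dist (l c z : R[i]) :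
  evalzz ((zvar - zzC l) * (zbarvar - zzC l^*) - zzC c) z = `|z - l| ^+ 2 - c.
Proof. by rewrite !evalzzE normCK rmorphB. Qed.

(** If [evalzz q l] were negative, the polynomials whose value at [l] is not nonnegative would form
    a tau-neighbourhood of [q], which would have to meet [A]. *)
Lemma closure_evalzz_Nlt0 (tau : lctopology (polyzz R)) (A : set (lcspace tau))
    (l : R[i]) :
  continuous ((fun p : polyzz R => evalzz p l) : lcspace tau -> R[i]^o) ->
  (forall q, A q -> 0 <= evalzz q l) ->
  forall q, closure A q -> ~ evalzz q l < 0.
Proof.
move=> lcont A0 q Aq q0.
have [r [/A0 r0]] := Aq _ (lcont q _ (nbhs_lt0 _ _ q0)).
by move/negP; apply.
Qed.

End EvalZZ.

(* In the order of R[i], 0 <= x means that x is real and nonnegative. *)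
Theorem proposition24 (R : realType) (Z : set R[i])
    (tau : lctopology (polyzz R)) :
  closed (Z : set R[i]^o) -> Z <> setT -> determining Z -> evaluable tau ->
  exists p : polyzz R,
    [/\ (forall z, Z z -> 0 <= evalzz p z),
        ~ closure (Sigma2 Z : set (lcspace tau)) p &
        ~ Sigma2 Z p].
Proof.
move=> Zcl ZT Zdet tauev.
have Zop : open (~` (Z : set R[i]^o)) by exact: closed_openC.
have [l [[nZl l0] lcont]] : exists l : R[i], (~ Z l /\ l != 0) /\
    continuous ((fun p : polyzz R => evalzz p l) : lcspace tau -> R[i]^o).
  have [w nZw] : exists w, ~ Z w.
    by apply/existsNP => ZA; apply: ZT; apply/seteqP; split.
  have U0 : (~` (Z : set R[i]^o) `&` ~` [set (0 : R[i]^o)]) !=set0.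
    (* Positivity of sums of squares is known only off 0. If the point found outside [Z] is 0, the
       point [e / 2] of a ball around it that misses [Z] replaces it. *)
    have [w0|w0] := eqVneq w 0; last by exists w; split => //; apply/eqP.
    have /nbhs_ballP[e /= e0 eZ] : nbhs (w : R[i]^o) (~` Z).
      exact: open_nbhs_nbhs.
    exists (e / 2); split; last by apply/eqP; rewrite gt_eqF// divr_gt0.
    apply: eZ; rewrite /ball /= w0 sub0r normrN gtr0_norm ?divr_gt0//.
    by rewrite ltr_pdivrMr// ltr_pMr// ltr1n.
  have Uop : open (~` (Z : set R[i]^o) `&` ~` [set (0 : R[i]^o)]).
    apply: openI => //; apply: closed_openC.
    apply: accessible_closed_set1; apply: hausdorff_accessible.
    exact: norm_hausdorff.
  have [l [[nZl l0] lc]] := tauev _ U0 Uop.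
  by exists l; split => //; split => //; apply/eqP.
have /nbhs_ballP[e /= e0 eZ] : nbhs (l : R[i]^o) (~` Z).
  exact: open_nbhs_nbhs.
have ncl : ~ closure (Sigma2 Z : set (lcspace tau))
    ((zvar R - zzC R l) * (zbarvar R - zzC R l^*) - zzC R (e ^+ 2)).
  have S0 q : Sigma2 Z q -> 0 <= evalzz q l by move=> /Sigma2_ge0; exact.
  move=> /(closure_evalzz_Nlt0 _ _ _ _ lcont S0); apply.
  by rewrite evalzz_sqr_dist subrr normr0 expr0n sub0r oppr_lt0 exprn_gt0.
eexists; split; [|exact: ncl|by move=> Sp; apply/ncl/subset_closure].
move=> z Zz; rewrite evalzz_sqr_dist subr_ge0.
(* A point of [Z] closer to [l] than [e] would lie in the ball chosen to miss [Z]. *)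
apply: sqr_le_norm => //; apply/negP => zl.
by apply: (eZ z) => //; rewrite /ball /= distrC.
Qed.
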